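(* Let $K_{\mathrm{pf}}$ be the class of structures in which each relation is a partial function, and let $O$ be any first-order definable operation on binary relations. The following are equivalent: (1) $O$ is function preserving and forward over $K_{\mathrm{pf}}$; (2) $O$ is term definable in $\mathbb{BRA}(\circ,{\sim},\cap,\sqcup)$ over $K_{\mathrm{pf}}$.
   Context: Structures are over a signature $\{R_1,\dots,R_n\}$ of binary relation symbols. An $n$-ary operation on binary relations is an isomorphism-invariant map $O$ sending each structure $A$ to a relation $O(A)\subseteq\mathrm{dom}(A)^2$; it is first-order definable if given by a first-order formula $\phi(x,y)$. $O$ is function preserving if whenever every $R_i^A$ is a partial function, $O(A)$ is a partial function. For $a\in\mathrm{dom}(A)$, $A_a$ is the induced substructure of $A$ on all elements reachable from $a$ by a finite directed path along $R_1^A,\dots,R_n^A$; $O$ is forward over a class $K$ if for all $A\in K$ and $a,b\in\mathrm{dom}(A)$: $(a,b)\in O(A)$ iff $(a,b)\in O(A_a)$. $\mathbb{BRA}(\mathcal{O})$ has as terms the expressions built from $R_1,\dots,R_n$ using operations in $\mathcal{O}$; $O$ is term definable over $K$ if some term defines the same relation as $O$ on every structure in $K$. The operations: $\circ$ is relational composition; ${\sim}R=\{(x,x)\mid\neg\exists y\,R(x,y)\}$ (antidomain); $\cap$ is intersection; $R\sqcup S=R\cup\{(x,y)\in S\mid\neg\exists z\,R(x,z)\}$ (preferential union). *)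

(* Defs.v *)
From mathcomp Require Import all_boot.
From Stdlib Require Import Relations.Relation_Operators.

Set Implicit Arguments.
Unset Strict Implicit.
Unset Printing Implicit Defensive.

Definition brel (D : Type) := D -> D -> Prop.

Section BRelOps.
Variable D : Type.
Implicit Types R S : brel D.

Definition is_partial_function R := forall x y z, R x y -> R x z -> y = z.

Definition comp R S : brel D := fun x y => exists z, R x z /\ S z y.
Definition antidomain R : brel D := fun x y => x = y /\ ~ (exists z, R x z).
Definition inter R S : brel D := fun x y => R x y /\ S x y.
Definition prefunion R S : brel D :=
  fun x y => R x y \/ (S x y /\ ~ (exists z, R x z)).
End BRelOps.

Record structure (n : nat) := Structure {
  dom :> Type;
  rel_of : 'I_n -> brel dom
}.

Definition is_isomorphism n (A B : structure n) (f : A -> B) :=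
  bijective f /\ forall i x y, rel_of i x y <-> rel_of i (f x) (f y).

Record operation (n : nat) := Operation {
  op_fun :> forall A : structure n, brel A;
  op_iso : forall (A B : structure n) (f : A -> B), is_isomorphism f ->
    forall x y, op_fun x y <-> op_fun (f x) (f y)
}.

(* First-order logic with equality. Variables are natural numbers; the
   remaining connectives and the universal quantifier are the usual
   abbreviations (satisfaction is read classically). *)
Inductive formula (n : nat) : Type :=
| FEq of nat & nat
| FRel of 'I_n & nat & nat
| FNot of formula n
| FAnd of formula n & formula n
| FEx of nat & formula n.

Fixpoint free_vars n (phi : formula n) : seq nat :=
  match phi with
  | FEq u v => [:: u; v]
  | FRel _ u v => [:: u; v]
  | FNot p => free_vars p
  | FAnd p q => free_vars p ++ free_vars q
  | FEx v p => [seq u <- free_vars p | u != v]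
  end.

Definition update (D : Type) (e : nat -> D) (v : nat) (d : D) : nat -> D :=
  fun u => if u == v then d else e u.

Fixpoint sat n (A : structure n) (e : nat -> A) (phi : formula n) : Prop :=
  match phi with
  | FEq u v => e u = e v
  | FRel i u v => rel_of i (e u) (e v)
  | FNot p => ~ sat e p
  | FAnd p q => sat e p /\ sat e q
  | FEx v p => exists d : A, sat (update e v d) p
  end.

(* In phi(x, y), x is variable 0 and y is variable 1; the value assigned to
   the other variables is irrelevant, as they do not occur free. *)
Definition fo_definable n (O : operation n) :=
  exists phi : formula n,
    {subset free_vars phi <= [:: 0; 1]} /\
    forall (A : structure n) (a b : A),
      O A a b <-> sat (fun v => if v == 0 then a else b) phi.

Definition Kpf n (A : structure n) : Prop :=
  forall i, is_partial_function (@rel_of n A i).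

Definition function_preserving n (O : operation n) :=
  forall A : structure n, Kpf A -> is_partial_function (O A).

Definition step n (A : structure n) : brel A := fun x y => exists i, rel_of i x y.

Definition reachable n (A : structure n) : brel A := clos_refl_trans A (@step n A).

Definition generated n (A : structure n) (a : A) : structure n :=
  @Structure n {x : A | reachable a x}
    (fun i x y => rel_of i (proj1_sig x) (proj1_sig y)).

(* O(A_a) is read as a relation on dom(A) through the inclusion of A_a in A;
   in particular (a, b) is not in O(A_a) when b lies outside A_a. *)
Definition op_generated n (O : operation n) (A : structure n) (a : A) : brel A :=
  fun x y => exists u v : generated a,
    [/\ proj1_sig u = x, proj1_sig v = y & O (generated a) u v].

Definition forward_over n (K : structure n -> Prop) (O : operation n) :=
  forall A : structure n, K A ->
  forall a b : A, O A a b <-> op_generated O a a b.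

Inductive term (n : nat) : Type :=
| TSym of 'I_n
| TComp of term n & term n
| TAnti of term n
| TInter of term n & term n
| TPref of term n & term n.

Fixpoint eval_term n (A : structure n) (t : term n) : brel A :=
  match t with
  | TSym i => @rel_of n A i
  | TComp s t => comp (eval_term s) (eval_term t)
  | TAnti s => antidomain (eval_term s)
  | TInter s t => inter (eval_term s) (eval_term t)
  | TPref s t => prefunion (eval_term s) (eval_term t)
  end.

Definition term_definable_over n (K : structure n -> Prop) (O : operation n) :=
  exists t : term n, forall A : structure n, K A ->
  forall a b : A, O A a b <-> eval_term t a b.

(* Main.v *)
(* For the hard direction, embed every structure [A] of partial functions as an
   outgoing-closed part of a structure [ext A] that realizes every pattern of
   fresh points pointing into it. A back-and-forth argument in these
   extensions shows that the truth of a formula depends only on which words of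
   bounded length, applied to the parameters, are defined and which of them
   have equal values; forwardness transfers this to [A] itself. If
   [(a, b)] is in [O A], then [b] is the value at [a] of a word of bounded length:
   otherwise a fresh copy of [b] would have the same type over [a], and [O]
   would be multivalued. Hence [O] is a finite case distinction, over equality
   tests of bounded words at [a], between bounded words, which is expressed by
   antidomain, intersection, composition and preferential union. *)

Require Import Defs.
From mathcomp Require Import all_boot.
From Stdlib Require Import Classical ClassicalEpsilon.
From Stdlib Require Import Relations.Relation_Operators.

Set Implicit Arguments.
Unset Strict Implicit.
Unset Printing Implicit Defensive.

(** * Bijections and stationary chains *)

Lemma inj_surj_bijective (T U : Type) (f : T -> U) :
  injective f -> (forall y, exists x, f x = y) -> bijective f.
Proof.
move=> f_inj f_surj.
pose g y := proj1_sig (constructive_indefinite_description _ (f_surj y)).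
have fgK y : f (g y) = y.
  exact: proj2_sig (constructive_indefinite_description _ (f_surj y)).
by exists g => // x; apply: f_inj.
Qed.

(** An increasing chain of subsets of a finite list grows only finitely often; the bound depends on
    the list alone, not on the chain. *)
Lemma chain_stabilizes (T : eqType) (l : seq T) :
  exists b, forall P : nat -> T -> Prop,
    (forall j x, P j x -> P j.+1 x) ->
    exists2 j, j <= b & forall x, x \in l -> P j.+1 x -> P j x.
Proof.
elim: l => [|a l [b IH]]; first by exists 0 => P _; exists 0.
(* Within [b] steps the tail is stationary; if [a] enters just then, one step admits it for good and
   at most [b] more suffice. *)
exists (b + b.+1) => P Pmono.
have [j jb stab] := IH P Pmono.
have [[Pa nPa]|stab_a] := classic (P j.+1 a /\ ~ P j a); last first.
  exists j; first exact: leq_trans jb (leq_addr _ _).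
  move=> x; rewrite inE => /orP[/eqP-> Pa|]; last exact: stab.
  by apply: NNPP => nPa; apply: stab_a.
have Pa_after k : P (k + j.+1) a by elim: k => //= k; apply: Pmono.
have [k kb stab'] := IH (fun k => P (k + j.+1)) (fun k => @Pmono (k + j.+1)).
exists (k + j.+1); first by rewrite leq_add.
move=> x; rewrite inE => /orP[/eqP-> _|]; first exact: Pa_after.
exact: stab'.
Qed.

(** * Words and outgoing-closed embeddings *)

Section Words.
Variable n : nat.
Implicit Types (A B : structure n) (w : seq 'I_n).

Fixpoint wrel A w : brel A :=
  if w is i :: w' then Defs.comp (@rel_of n A i) (@wrel A w') else fun x y => x = y.

Lemma wrel_fun A w : Kpf A -> is_partial_function (@wrel A w).
Proof.
move=> KA; elim: w => [|i w IH] x y z /=; first by move=> <- <-.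
by move=> [u [xu uy]] [v [xv vz]]; apply: IH uy _; rewrite (KA _ _ _ _ xu xv).
Qed.

Lemma wrel_cat A w1 w2 (x y : A) :
  wrel (w1 ++ w2) x y <-> Defs.comp (@wrel A w1) (@wrel A w2) x y.
Proof.
elim: w1 x => [|i w IH] x /=.
  by split=> [xy|[z [-> //]]]; exists x.
split=> [[z [xz /IH[u [zu uy]]]]|[u [[z [xz zu]] uy]]].
  by exists u; split => //; exists z.
by exists z; split => //; apply/IH; exists u.
Qed.

Lemma wrel_rcons A w i (x y : A) :
  wrel (rcons w i) x y <-> exists2 z, wrel w x z & rel_of i z y.
Proof.
rewrite -cats1 wrel_cat /=; split=> [[z [xz [u [zu <-]]]]|[z xz zy]].
  by exists z.
by exists z; split => //; exists y.
Qed.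

Lemma words_le_finite k : exists l : seq (seq 'I_n), forall w, size w <= k -> w \in l.
Proof.
elim: k => [|k [l lP]]; first by exists [:: [::]] => -[].
exists ([::] :: [seq i :: w | i <- enum 'I_n, w <- l]) => -[|i w] //= wk.
by rewrite inE /= allpairs_f ?mem_enum // lP.
Qed.

(** With the same word at the same point this says that the word is defined there, so definedness
    and equality of values are treated together. *)
Definition meets A (x : A) w (y : A) w' := exists z, wrel w x z /\ wrel w' y z.

(** No edge of [A] leaves the image of [B], so undefinedness is preserved too, as antidomain and
    preferential union require. *)
Definition closed_embedding B A (f : B -> A) :=
  injective f /\
  forall i x y, rel_of i (f x) y <-> exists2 z, rel_of i x z & y = f z.

Lemma closed_embedding_wrel B A (f : B -> A) w x y : closed_embedding f ->
  wrel w (f x) y <-> exists2 z, wrel w x z & y = f z.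
Proof.
move=> [f_inj f_rel]; elim: w x y => [|i w IH] x y /=.
  by split=> [<-|[z <- ->//]]; exists x.
split=> [[u [/f_rel[v xv ->] /IH[z vz ->]]]|[z [v [xv vz]] ->]].
  by exists z => //; exists v.
by exists (f v); split; [apply/f_rel; exists v|apply/IH; exists z].
Qed.

Lemma closed_embedding_meets B A (f : B -> A) x w x' w' : closed_embedding f ->
  meets (f x) w (f x') w' <-> meets x w x' w'.
Proof.
move=> fP; split=> [[z [/(closed_embedding_wrel _ _ _ fP)[u xu ->]]]|[z [xz x'z]]].
  move=> /(closed_embedding_wrel _ _ _ fP)[v x'v /fP.1 uv].
  by exists u; split => //; rewrite uv.
by exists (f z); split; apply/(closed_embedding_wrel _ _ _ fP); exists z.
Qed.

Lemma closed_embedding_eval B A (f : B -> A) t x y : closed_embedding f ->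
  eval_term t (f x) y <-> exists2 z, eval_term t x z & y = f z.
Proof.
move=> fP; have [f_inj f_rel] := fP.
elim: t x y => [i|s IHs t IHt|s IHs|s IHs t IHt|s IHs t IHt] x y /=.
- exact: f_rel.
- split=> [[u [/IHs[v xv ->] /IHt[z vz ->]]]|[z [v [xv vz]] ->]].
    by exists z => //; exists v.
  by exists (f v); split; [apply/IHs; exists v|apply/IHt; exists z].
- split=> [[<- nz]|[z [<- nz] ->]].
    exists x => //; split=> // -[z xz]; apply: nz.
    by exists (f z); apply/IHs; exists z.
  by split=> // -[u /IHs[v xv _]]; apply: nz; exists v.
- split=> [[/IHs[u xu ->] /IHt[v xv /f_inj uv]]|[z [sz tz] ->]].
    by exists u => //; split=> //; rewrite uv.
  by split; [apply/IHs; exists z|apply/IHt; exists z].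
- split=> [[/IHs[z xz ->]|[/IHt[z xz ->] nz]]|[z [xz|[xz nz]] ->]].
  + by exists z => //; left.
  + exists z => //; right; split=> // -[u xu]; apply: nz.
    by exists (f u); apply/IHs; exists u.
  + by left; apply/IHs; exists z.
  + right; split; first by apply/IHt; exists z.
    by move=> [u /IHs[v xv _]]; apply: nz; exists v.
Qed.

Lemma generated_eq A (a : A) (u v : generated a) :
  proj1_sig u = proj1_sig v -> u = v.
Proof.
case: u v => [x xP] [y yP] /= xy; case: _ / xy yP => yP.
by rewrite (proof_irrelevance _ xP yP).
Qed.

Lemma generated_closed A (a : A) :
  @closed_embedding (generated a) A (fun u => proj1_sig u).
Proof.
split=> [u v /generated_eq //|i u y]; split=> [uy|[z uz ->//]].
have ay : reachable a y.
  apply: rt_trans (proj2_sig u) _; apply: rt_step; by exists i.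
by exists (exist _ y ay).
Qed.

Lemma Kpf_closed B A (f : B -> A) : closed_embedding f -> Kpf A -> Kpf B.
Proof.
move=> [f_inj f_rel] KA i x y z xy xz; apply: f_inj.
by apply: (KA i (f x)); apply/f_rel; [exists y|exists z].
Qed.

Lemma closed_embedding_reachable B A (f : B -> A) x y : closed_embedding f ->
  reachable (f x) y <-> exists2 z, reachable x z & y = f z.
Proof.
move=> [f_inj f_rel]; split=> [fxy|[z xz ->]].
  have [u fx] : exists u, u = f x by exists (f x).
  rewrite -fx in fxy; elim: fxy x fx => {u y}.
  - move=> u v [i uv] x xu; move: uv; rewrite xu => /f_rel[z xz ->].
    by exists z => //; apply: rt_step; exists i.
  - by move=> u x ux; exists x => //; apply: rt_refl.
  - move=> u v w _ IHuv _ IHvw x /IHuv[z xz vz].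
    have [y zy wy] := IHvw z vz.
    by exists y => //; apply: rt_trans xz zy.
elim: xz => {x z}.
- by move=> x z [i xz]; apply: rt_step; exists i; apply/f_rel; exists z.
- by move=> x; apply: rt_refl.
- by move=> x y' z _ IH1 _ IH2; apply: rt_trans IH1 IH2.
Qed.

(** [f] restricts to an isomorphism between the substructures generated by [x] and by [f x], and
    forwardness reduces both sides to these. *)
Lemma closed_embedding_forward (O : operation n) B A (f : B -> A) x y :
  closed_embedding f -> Kpf A -> forward_over (@Kpf n) O ->
  O B x y <-> O A (f x) (f y).
Proof.
move=> fP KA fwd.
have reach z : reachable x z -> reachable (f x) (f z).
  by move=> xz; apply/(closed_embedding_reachable _ _ fP); exists z.
pose F (u : generated x) : generated (f x) :=
  exist _ (f (proj1_sig u)) (reach _ (proj2_sig u)).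
have F_iso : is_isomorphism F.
  split; last first.
    move=> i u v /=; split=> [uv|/fP.2[z uz /fP.1 -> //]].
    by apply/fP.2; exists (proj1_sig v).
  apply: inj_surj_bijective => [u v [/fP.1 /generated_eq //]|[z xz]].
  have [v xv zv] := (closed_embedding_reachable _ _ fP).1 xz.
  by exists (exist _ v xv); apply: generated_eq.
have KB := Kpf_closed fP KA.
split=> [/(fwd _ KB)[u [v [ux vy Ouv]]]|/(fwd _ KA)[u [v [ux vy Ouv]]]].
  apply/(fwd _ KA); exists (F u), (F v); split; rewrite /= ?ux ?vy //.
  exact/(op_iso _ F_iso).
apply/(fwd _ KB); have [G FK GK] := F_iso.1.
exists (G u), (G v); split.
- by apply: fP.1; rewrite -ux -{2}(GK u).
- by apply: fP.1; rewrite -vy -{2}(GK v).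
- by apply/(op_iso _ F_iso); rewrite !GK.
Qed.

(** * From terms to function preservation and forwardness *)

Lemma eval_term_fun t A : Kpf A -> is_partial_function (@eval_term n A t).
Proof.
move=> KA; elim: t => [i|s IHs t IHt|s IHs|s IHs t IHt|s IHs t IHt] x y z /=.
- exact: KA.
- by move=> [u [xu uy]] [v [xv vz]]; apply: IHt uy _; rewrite (IHs _ _ _ xu xv).
- by move=> [<- _] [<- _].
- by move=> [xy _] [xz _]; apply: IHs xy xz.
- move=> [xy|[xy ny]] [xz|[xz nz]].
  + exact: IHs xy xz.
  + by case: nz; exists y.
  + by case: ny; exists z.
  + exact: IHt xy xz.
Qed.

Lemma term_definable_forward (O : operation n) :
  term_definable_over (@Kpf n) O ->
  function_preserving O /\ forward_over (@Kpf n) O.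
Proof.
move=> [t tP]; split=> [A KA x y z /(tP _ KA) xy /(tP _ KA) xz|A KA a b].
  exact: eval_term_fun KA _ _ _ xy xz.
have gP := @generated_closed A a; have KG := Kpf_closed gP KA.
pose a0 : generated a := exist _ a (rt_refl _ _ _).
split=> [/(tP _ KA) ab|[u [v [ua <- /(tP _ KG) uv]]]].
  have [v av bv] := (closed_embedding_eval t a0 b gP).1 ab.
  by exists a0, v; split=> //; apply/(tP _ KG).
apply/(tP _ KA); rewrite -{1}ua.
by apply/(closed_embedding_eval _ _ _ gP); exists v.
Qed.

End Words.

(** * Extensions by fresh points and one back-and-forth round *)

Section Extension.
Variable n : nat.
Implicit Types (A : structure n) (w : seq 'I_n).

(* [Node z l t w] is the fresh point indexed by the word [w] in a copy of the
   pattern [t]: its [i]-successor [t w i] is absent, another fresh point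
   ([inl]), or one of the old points listed by [l] ([inr]). Mentioning [z] and
   all of [l] makes the fresh points different from them. *)
Inductive ext_dom A : Type :=
| Base of A
| Node of ext_dom A & nat -> seq 'I_n -> ext_dom A &
    seq 'I_n -> 'I_n -> option (seq 'I_n + nat * seq 'I_n) & seq 'I_n.

Definition decode A (z : ext_dom A) l t (c : seq 'I_n + nat * seq 'I_n) :=
  match c with inl w => Node z l t w | inr p => l p.1 p.2 end.

Definition ext_rel A (i : 'I_n) (x y : ext_dom A) : Prop :=
  match x with
  | Base a => exists2 b, rel_of i a b & y = Base b
  | Node z l t w =>
      if t w i is Some c then y = decode z l t c else False
  end.

Definition ext A : structure n := @Structure n (ext_dom A) (@ext_rel A).

Lemma ext_Kpf A : Kpf A -> Kpf (ext A).
Proof.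
move=> KA i [a|z l t w] x y /=.
  by move=> [b ab ->] [c ac ->]; rewrite (KA _ _ _ _ ab ac).
by case: (t w i) => // c -> ->.
Qed.

Lemma Base_closed A : @closed_embedding n A (ext A) (@Base A).
Proof. by split=> [x y [] |]. Qed.

(** Constructor terms are well founded, so a [Node] never equals one of its immediate subterms. *)
Lemma Node_fresh A (z : ext_dom A) l t w :
  Node z l t w <> z /\ forall u v, Node z l t w <> l u v.
Proof.
suff H (x : ext_dom A) : forall z l t w, x = Node z l t w ->
    x <> z /\ forall u v, x <> l u v by exact: H.
elim: x => [a|x IHx f IHf r j] // {}z {}l {}t {}w [<- <- _ _].
split=> [E|u v E].
  by have [/(_ erefl)] := IHx _ _ _ _ (esym E).
by have [_ /(_ u v erefl)] := IHf _ _ _ _ _ _ (esym E).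
Qed.

Definition sim k A (e : nat -> A) A' (e' : nat -> A') : Prop :=
  forall u w v w', size w <= k -> size w' <= k ->
    meets (e u) w (e v) w' <-> meets (e' u) w (e' v) w'.

Definition near A (e : nat -> A) k (y : A) : Prop :=
  exists u w, size w <= k /\ wrel w (e u) y.

Lemma near_le A (e : nat -> A) k k' y : k <= k' -> near e k y -> near e k' y.
Proof.
by move=> kk' [u [w [wk wy]]]; exists u, w; split=> //; apply: leq_trans kk'.
Qed.

Lemma sim_le k k' A (e : nat -> A) A' (e' : nat -> A') :
  k <= k' -> sim k' e e' -> sim k e e'.
Proof.
move=> kk' S u w v w' wk w'k.
by apply: S; [apply: leq_trans wk _|apply: leq_trans w'k _].
Qed.

(* [d'] is chosen so that [iota] below matches the points near [d] with points near
   [d']. Points in [S], the ball of radius [s + j] around [e], must go to their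
   counterparts around [e']; the others go to fresh points. This respects edges
   only if no edge inside the [s]-ball around [d] leaves [S], which holds for
   some [j] because that ball is finite. *)
Lemma sim_extend s : exists k, forall A A' (e : nat -> A) (e' : nat -> ext A') d z,
  Kpf A -> Kpf A' -> sim k e e' -> exists d',
  (forall v, sim s (update e v d) (update e' v d')) /\ (near e k d \/ d' <> z).
Proof.
have [W WP] := words_le_finite n s.
have [b bP] := chain_stabilizes W.
(* [s + b] bounds the radius of [S]; the extra one follows an edge starting in [S]. *)
exists (s + b).+1 => A A' e e' d z KA KA' ee'.
have KE := ext_Kpf KA'.
(* The chain consists of the words whose value at [d] lies in the ball of radius [s + j] around
   [e]. *)
have [j jb stabW] := bP (fun j w => exists2 y, wrel w d y & near e (s + j) y)
  (fun j w '(ex_intro2 y dy yj) =>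
     ex_intro2 _ _ y dy (near_le (leq_add (leqnn s) (leqnSn j)) yj)).
pose S y := near e (s + j) y.
have jb' : s + j <= (s + b).+1 by rewrite leqW // leq_add2l.
have jb1 : (s + j).+1 <= (s + b).+1 by rewrite ltnS leq_add2l.
have stab w y : size w <= s -> wrel w d y -> near e (s + j).+1 y -> S y.
  move=> ws dy yj; have [|y' dy' Sy'] := stabW w (WP _ ws).
    by exists y; rewrite ?addnS.
  by rewrite (wrel_fun KA dy dy').
pose H y y' := exists u w,
  [/\ size w <= (s + b).+1, wrel w (e u) y & wrel w (e' u) y'].
have H_ex u w y : size w <= (s + b).+1 -> wrel w (e u) y ->
    exists2 y', wrel w (e' u) y' & H y y'.
  move=> wb uy; have [|y' [uy' _]] := (ee' u w u w wb wb).1; first by exists y.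
  by exists y' => //; exists u, w.
have H_ex' u w y' : size w <= (s + b).+1 -> wrel w (e' u) y' ->
    exists2 y, wrel w (e u) y & H y y'.
  move=> wb uy'; have [|y [uy _]] := (ee' u w u w wb wb).2; first by exists y'.
  by exists y => //; exists u, w.
have H_inj x x' y y' : H x x' -> H y y' -> x = y <-> x' = y'.
  move=> [u [w [wb ux ux']]] [v [w' [w'b vy vy']]].
  have E0 := ee' u w v w' wb w'b; split=> E.
    have [|q [uq vq]] := E0.1; first by exists x; rewrite {2}E.
    by rewrite (wrel_fun KE ux' uq) (wrel_fun KE vy' vq).
  have [|q [uq vq]] := E0.2; first by exists x'; rewrite {2}E.
  by rewrite (wrel_fun KA ux uq) (wrel_fun KA vy vq).
(* [ref] names a point of [S] by a variable and a word, which [l] evaluates around [e']. [rep] fixes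
   one word per point, so words with equal values at [d] share a fresh point. *)
pose l u w := epsilon (inhabits z) (fun y' => wrel w (e' u) y').
pose ref y := epsilon (inhabits (0, [::]))
  (fun p => size p.2 <= s + j /\ wrel p.2 (e p.1) y).
pose rep y := epsilon (inhabits [::]) (fun w => wrel w d y).
pose code y : seq 'I_n + nat * seq 'I_n :=
  if excluded_middle_informative (S y) then inr (ref y) else inl (rep y).
have repP w y : wrel w d y -> wrel (rep y) d y.
  by move=> dy; apply: (epsilon_spec (inhabits [::]) (fun w => wrel w d y)); exists w.
have [t tP] : exists t : seq 'I_n -> 'I_n -> option (seq 'I_n + nat * seq 'I_n),
    forall w i c, t w i = Some c <-> exists2 y, wrel (rcons w i) d y & c = code y.
  pose E w i := exists y, wrel (rcons w i) d y.
  exists (fun w i => if excluded_middle_informative (E w i) then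
    Some (code (epsilon (inhabits d) (fun y => wrel (rcons w i) d y))) else None).
  move=> w i c; case: excluded_middle_informative => [wi|nwi]; last first.
    by split=> // -[y dy _]; case: nwi; exists y.
  have dy := epsilon_spec (inhabits d) _ wi.
  split=> [[<-]|[y' dy' ->]]; first by eexists; first exact: dy.
  by rewrite (wrel_fun KA dy dy').
pose iota y := decode z l t (code y).
have iota_in y : S y -> H y (iota y).
  move=> Sy; rewrite /iota /code; case: excluded_middle_informative => // _ /=.
  have [rs ry] : size (ref y).2 <= s + j /\ wrel (ref y).2 (e (ref y).1) y.
    apply: (epsilon_spec (inhabits (0, [::]))
      (fun p => size p.2 <= s + j /\ wrel p.2 (e p.1) y)).
    by have [u [w uw]] := Sy; exists (u, w).
  have rb := leq_trans rs jb'.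
  have [y' ry' _] := H_ex _ _ _ rb ry.
  exists (ref y).1, (ref y).2; split=> //.
  by apply: (epsilon_spec (inhabits z)); exists y'.
have iota_out y : ~ S y -> iota y = Node z l t (rep y).
  by rewrite /iota /code; case: excluded_middle_informative.
have H_iota y y' : S y -> H y y' -> y' = iota y.
  by move=> /iota_in yi yy'; apply/(H_inj _ _ _ _ yy' yi).
have fresh y x : ~ S y -> S x -> iota y <> iota x.
  move=> nSy Sx; rewrite iota_out // /iota /code.
  by case: excluded_middle_informative => // _ /=; apply: (Node_fresh z l t _).2.
pose known y := S y \/ exists w, wrel w d y.
have iota_inj x y : known x -> known y -> iota x = iota y -> x = y.
  move=> kx ky; have [Sx|nSx] := classic (S x); have [Sy|nSy] := classic (S y).
  - by move/(H_inj _ _ _ _ (iota_in _ Sx) (iota_in _ Sy)).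
  - by move/esym/fresh; case.
  - by move/fresh; case.
  have [//|[w dx]] := kx; have [//|[w' dy]] := ky.
  rewrite !iota_out // => -[r].
  by apply: (wrel_fun KA (repP _ _ dx)); rewrite r; apply: repP dy.
(* Outside [S] the table [t] provides the edges; inside, [stab] keeps successors in [S], where [sim]
   matches them. The strict bound leaves room for one more letter. *)
have iota_step w x i y' : size w < s -> wrel w d x ->
    @rel_of n (ext A') i (iota x) y' <-> exists2 y, rel_of i x y & y' = iota y.
  move=> ws dx; have [Sx|nSx] := classic (S x); last first.
    rewrite iota_out //=; case E: (t (rep x) i) => [c|]; last first.
      split=> // -[y xy _]; suff: t (rep x) i = Some (code y) by rewrite E.
      by apply/tP; exists y => //; apply/wrel_rcons; exists x => //; apply: repP dx.
    have [y /wrel_rcons[x0 rx0 x0y] ->] := (tP _ _ _).1 E.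
    rewrite (wrel_fun KA rx0 (repP _ _ dx)) in x0y.
    split=> [->|[y0 xy0 ->]]; first by exists y.
    by rewrite (KA _ _ _ _ x0y xy0).
  have [u [v [vs ux]]] := Sx.
  have vb : size (rcons v i) <= (s + b).+1.
    by rewrite size_rcons; apply: leq_trans jb1.
  have [x' ux' xx'] := H_ex _ _ _ (leq_trans vs jb') ux.
  have x'E := H_iota _ _ Sx xx'; rewrite x'E in ux'.
  have Sstep y : rel_of i x y -> S y.
    move=> xy; apply: (stab (rcons w i)); rewrite ?size_rcons //.
      by apply/wrel_rcons; exists x.
    exists u, (rcons v i); split; first by rewrite size_rcons.
    by apply/wrel_rcons; exists x.
  split=> [xy'|[y xy ->]].
    have [|y /wrel_rcons[x0 ux0 x0y] yy'] := H_ex' u _ y' vb.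
      by apply/wrel_rcons; exists (iota x).
    rewrite (wrel_fun KA ux0 ux) in x0y.
    by exists y => //; apply: H_iota => //; apply: Sstep.
  have [|y1 /wrel_rcons[x0 ux0 x0y] yy1] := H_ex u _ y vb.
    by apply/wrel_rcons; exists x.
  by rewrite -(H_iota _ _ (Sstep _ xy) yy1) -(wrel_fun KE ux0 ux').
have iota_path w w0 x y' : size w0 + size w <= s -> wrel w0 d x ->
    @wrel n (ext A') w (iota x) y' <-> exists2 y, wrel w x y & y' = iota y.
  elim: w w0 x y' => [|i w IH] w0 x y' /= ws dx.
    by split=> [<-|[y <- ->//]]; exists x.
  have w0s : size w0 < s by apply: leq_trans ws; rewrite addnS ltnS leq_addr.
  have ws1 : size (rcons w0 i) + size w <= s by rewrite size_rcons addSnnS.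
  split=> [[q [/(iota_step _ _ _ _ w0s dx)[y xy ->]]]|[y [q [xq qy]] ->]].
    have dy : wrel (rcons w0 i) d y by apply/wrel_rcons; exists x.
    by move=> /(IH _ _ _ ws1 dy)[p yp ->]; exists p => //; exists y.
  have dq : wrel (rcons w0 i) d q by apply/wrel_rcons; exists x.
  exists (iota q); split; first by apply/(iota_step _ _ _ _ w0s dx); exists q.
  by apply/(IH _ _ _ ws1 dq); exists y.
exists (iota d); split=> [v|]; last first.
  have [Sd|nSd] := classic (S d); first by left; apply: near_le Sd.
  by right; rewrite iota_out //; apply: (Node_fresh z l t _).1.
have upd_known p w y : size w <= s -> wrel w (update e v d p) y -> known y.
  rewrite /update; case: eqP => _ ws py; first by right; exists w.
  by left; exists p, w; split=> //; apply: leq_trans ws (leq_addr _ _).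
have upd_path p w y' : size w <= s -> @wrel n (ext A') w (update e' v (iota d) p) y' <->
    exists2 y, wrel w (update e v d p) y & y' = iota y.
  rewrite /update; case: eqP => _ ws; first exact: (iota_path w [::]).
  have wj : size w <= s + j := leq_trans ws (leq_addr _ _).
  have wb := leq_trans wj jb'.
  split=> [py'|[y py ->]].
    have [y py yy'] := H_ex' _ _ _ wb py'.
    by exists y => //; apply: H_iota yy'; exists p, w.
  have [y1 py1 yy1] := H_ex _ _ _ wb py.
  by rewrite -(H_iota y y1) //; exists p, w.
move=> p w q w' ws w's; split=> [[y [py qy]]|[y' [py' qy']]].
  by exists (iota y); split; apply/upd_path => //; exists y.
have [y py yE] := (upd_path _ _ _ ws).1 py'.
have [x qx xE] := (upd_path _ _ _ w's).1 qy'.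
exists y; split=> //.
by rewrite (iota_inj y x) // -?yE //; [apply: upd_known py|apply: upd_known qx].
Qed.

End Extension.

(** * Locality of formulas and of forward operations *)

Section Locality.
Variable n : nat.
Implicit Types (A B : structure n) (w : seq 'I_n).

Lemma sim_sym k A (e : nat -> A) A' (e' : nat -> A') : sim k e e' -> sim k e' e.
Proof. by move=> S u w v w' wk w'k; split=> /(S _ _ _ _ wk w'k). Qed.

Lemma sim_closed k B A (f : B -> A) (e : nat -> B) :
  closed_embedding f -> sim k e (fun v => f (e v)).
Proof. by move=> fP u w v w' _ _; split=> /(closed_embedding_meets _ _ _ _ fP). Qed.

Lemma sim_trans k A1 A2 A3 (e1 : nat -> A1) (e2 : nat -> A2) (e3 : nat -> A3) :
  sim k e1 e2 -> sim k e2 e3 -> sim k e1 e3.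
Proof.
move=> S12 S23 u w v w' wk w'k.
by split=> [/S12 E|/S23 E]; [apply/S23/E|apply/S12/E].
Qed.

(** Every witness has a counterpart in the other extension, so a quantifier only costs longer words;
    negation uses the symmetry of [sim]. *)
Lemma sat_sim (phi : formula n) : exists k,
  forall A A' (e : nat -> ext A) (e' : nat -> ext A'),
  Kpf A -> Kpf A' -> sim k e e' -> sat e phi -> sat e' phi.
Proof.
elim: phi => [u v|i u v|p [k IH]|p [k IHp] q [l IHq]|v p [k IH]] /=.
- exists 0 => A A' e e' _ _ S uv.
  have [|y [/= -> ->//]] := (S u [::] v [::] isT isT).1.
  by exists (e v); rewrite /= uv.
- exists 1 => A A' e e' _ _ S uv.
  have [|y [/= [x [ux <-]] ->//]] := (S u [:: i] v [::] isT isT).1.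
  by exists (e v); split=> //=; exists (e v).
- exists k => A A' e e' KA KA' S np /(IH _ _ _ _ KA' KA) p'.
  by apply: np; apply: p'; apply: sim_sym.
- exists (maxn k l) => A A' e e' KA KA' S [pe qe]; split.
    by apply: IHp pe => //; apply: sim_le S; apply: leq_maxl.
  by apply: IHq qe => //; apply: sim_le S; apply: leq_maxr.
- have [l lP] := sim_extend n k; exists l => A A' e e' KA KA' S [d pd].
  have [d' [Sd _]] := lP (ext A) _ _ _ d (e' 0) (ext_Kpf KA) KA' S.
  by exists d'; apply: IH pd.
Qed.

Lemma forward_local (O : operation n) : fo_definable O -> forward_over (@Kpf n) O ->
  exists k, forall A A' a b a' b', Kpf A -> Kpf A' ->
    sim k (fun v => if v == 0 then a else b) (fun v => if v == 0 then a' else b') ->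
    O A a b -> O A' a' b'.
Proof.
move=> [phi [_ phiP]] fwd; have [k kP] := sat_sim phi.
exists k => A A' a b a' b' KA KA' S.
move=> /(closed_embedding_forward _ _ (Base_closed A) (ext_Kpf KA) fwd) /phiP Oab.
apply/(closed_embedding_forward _ _ (Base_closed A') (ext_Kpf KA') fwd)/phiP.
apply: kP Oab => //.
have E (B : structure n) (x y : B) :
    @sim n k B (fun v => if v == 0 then x else y)
      (ext B) (fun v => if v == 0 then Base x else Base y).
  move=> u w v w' wk w'k.
  rewrite (sim_closed (fun v => if v == 0 then x else y) (Base_closed B) u v wk w'k).
  by case: (u == 0); case: (v == 0).
exact: sim_trans (sim_sym (E _ _ _)) (sim_trans S (E _ _ _)).
Qed.

Lemma forward_near (O : operation n) : fo_definable O -> forward_over (@Kpf n) O ->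
  function_preserving O ->
  exists m, forall A a b, Kpf A -> O A a b -> exists2 w, size w <= m & wrel w a b.
Proof.
move=> fo fwd fp; have [k kP] := forward_local fo fwd.
have [m mP] := sim_extend n k; exists m => A a b KA Oab.
have KE := ext_Kpf KA.
(* If [b] is not near [a], its counterpart [d'] over [Base a] differs from [Base b], and [O] would
   relate [Base a] to both. *)
have [d' [S [[_ [w [wm ab]]]|d'b]]] := mP _ _ (fun=> a) _ b (Base b) KA KA
    (sim_closed (fun=> a) (Base_closed A)); first by exists w.
case: d'b; apply: (fp _ KE (Base a : ext A)); last first.
  exact/(closed_embedding_forward _ _ (Base_closed A) KE fwd).
apply: kP Oab => // -[|u] w [|v] w' wk w'k.
- exact: (S 1 0 w 0 w').
- exact: (S 1 0 w 1 w').
- exact: (S 1 1 w 0 w').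
- exact: (S 1 1 w 1 w').
Qed.

Lemma meets_cat A (a b c : A) w w' v v' : Kpf A -> wrel w a b -> wrel v a c ->
  meets b w' c v' <-> meets a (w ++ w') a (v ++ v').
Proof.
move=> KA ab ac; split=> [[z [bz cz]]|[z [/wrel_cat[x [ax xz]] /wrel_cat[y [ay yz]]]]].
  by exists z; split; apply/wrel_cat; [exists b|exists c].
by exists z; rewrite (wrel_fun KA ab ax) (wrel_fun KA ac ay).
Qed.

(** As [b] is the value of [w] at [a], words of length at most [k] at [b] become words of length at
    most [m + k] at [a]: the type of [a] determines that of the pair. *)
Lemma forward_word_local (O : operation n) k m A A' a b a' w : Kpf A -> Kpf A' ->
  (forall A A' a b a' b', Kpf A -> Kpf A' ->
    sim k (fun v => if v == 0 then a else b) (fun v => if v == 0 then a' else b') ->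
    O A a b -> O A' a' b') ->
  sim (m + k) (fun=> a : A) (fun=> a' : A') -> size w <= m -> wrel w a b ->
  O A a b -> exists2 b', wrel w a' b' & O A' a' b'.
Proof.
move=> KA KA' loc S wm ab Oab.
have wmk : size w <= m + k := leq_trans wm (leq_addr _ _).
have [|b' [ab' _]] := (S 0 w 0 w wmk wmk).1; first by exists b.
exists b' => //; apply: loc Oab => // u v p v' vk v'k.
have pre q r : size r <= k ->
    size ((if q == 0 then [::] else w) ++ r) <= m + k.
  by move=> rk; rewrite size_cat leq_add //; case: (q == 0).
have path q : wrel (if q == 0 then [::] else w) a (if q == 0 then a else b).
  by case: (q == 0).
have path' q : wrel (if q == 0 then [::] else w) a' (if q == 0 then a' else b').
  by case: (q == 0).
rewrite (meets_cat _ _ KA (path u) (path p)) (meets_cat _ _ KA' (path' u) (path' p)).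
by apply: (S 0 _ 0); apply: pre.
Qed.

End Locality.

(** * From finitely many tests to a term *)

Section Terms.
Variables (n : nat) (hn : 0 < n).
Implicit Types (A B : structure n) (w : seq 'I_n).

Definition empty_term : term n :=
  let s := TSym (Ordinal hn) in TComp (TAnti s) s.

(** The antidomain of the empty relation is the identity, which interprets the empty word. *)
Fixpoint word_term w : term n :=
  if w is i :: w' then TComp (TSym i) (word_term w') else TAnti empty_term.

Lemma eval_empty_term A (a b : A) : ~ eval_term empty_term a b.
Proof. by move=> [z [[<- na] ab]]; apply: na; exists b. Qed.

Lemma eval_word_term A w (a b : A) : eval_term (word_term w) a b <-> wrel w a b.
Proof.
elim: w a => [|i w IH] a /=.
  split=> [[] //|->]; split=> // -[z]; exact: eval_empty_term.
by split=> -[z [az /IH zb]]; exists z.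
Qed.

Lemma eval_meets_term A w w' (a : A) :
  (exists b, eval_term (TInter (word_term w) (word_term w')) a b) <-> meets a w a w'.
Proof.
by split=> -[b [/eval_word_term aw /eval_word_term aw']]; exists b; split=> //;
  apply/eval_word_term.
Qed.

(** A decision tree over [ps]: [G] is the condition established so far and [g] its subidentity. Once
    the tests in [ps] are decided as well, a single word computes [O] wherever they come out the
    same way. *)
Lemma term_of_tests (O : operation n) m (ps : seq (seq 'I_n * seq 'I_n)) :
  function_preserving O ->
  (forall A a b, Kpf A -> O A a b -> exists2 w, size w <= m & wrel w a b) ->
  forall (G : forall A, A -> Prop) g,
  (forall A a b, Kpf A -> eval_term g a b <-> a = b /\ G A a) ->
  (forall A A' a b a' w, Kpf A -> Kpf A' -> G A a -> G A' a' ->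
    (forall p, p \in ps -> meets a p.1 a p.2 <-> meets a' p.1 a' p.2) ->
    size w <= m -> wrel w a b -> O A a b -> exists2 b', wrel w a' b' & O A' a' b') ->
  exists t, forall A a b, Kpf A -> eval_term t a b <-> G A a /\ O A a b.
Proof.
move=> fp near_O; elim: ps => [|[w w'] ps IH] G g gP loc.
  (* No tests remain: either [O] is empty under [G], or one instance supplies a word valid
     throughout [G]. *)
  have [[A0 [a0 [b0 [K0 G0 O0]]]]|none] :=
      classic (exists A a b, [/\ Kpf A, G A a & O A a b]); last first.
    exists empty_term => A a b KA; split=> [/eval_empty_term//|[Ga Oab]].
    by case: none; exists A, a, b.
  have [w wm ab0] := near_O _ _ _ K0 O0.
  exists (TComp g (word_term w)) => A a b KA.
  split=> [[x [/(gP _ _ _ KA)[<- Ga] /eval_word_term ab]]|[Ga Oab]].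
    have [//|b' ab' Oab'] := loc _ _ _ _ a w K0 KA G0 Ga _ wm ab0 O0.
    by rewrite (wrel_fun KA ab ab').
  have [//|b' ab' Oab'] := loc _ _ _ _ a w K0 KA G0 Ga _ wm ab0 O0.
  exists a; split; first exact/gP.
  by apply/eval_word_term; rewrite (fp _ KA _ _ _ Oab Oab').
(* The double antidomain of [test] is the identity on its domain; [t1] and [t2] treat success and
   failure. *)
pose test := TInter (word_term w) (word_term w').
have [||t1 t1P] :=
    IH (fun A a => G A a /\ meets a w a w') (TInter g (TAnti (TAnti test))).
- move=> A a b KA /=; rewrite /inter gP // -eval_meets_term.
  split=> [[[<- Ga] [_ nn]]|[<- [Ga ab]]].
    split=> //; split=> //; apply: NNPP => nab.
    by apply: nn; exists a.
  by split=> //; split=> // -[z [_]].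
- move=> A A' a b a' v KA KA' [Ga a1] [Ga' a1'] ps_aa'.
  apply: loc => // p; rewrite inE => /orP[/eqP-> //|]; exact: ps_aa'.
have [||t2 t2P] :=
    IH (fun A a => G A a /\ ~ meets a w a w') (TInter g (TAnti test)).
- move=> A a b KA /=; rewrite /inter gP // -eval_meets_term.
  by split=> [[[<- Ga] [_ nn]]|[<- [Ga nn]]].
- move=> A A' a b a' v KA KA' [Ga a1] [Ga' a1'] ps_aa'.
  apply: loc => // p; rewrite inE => /orP[/eqP-> //|]; exact: ps_aa'.
(* [t1] is undefined where the test fails, so the preferential union is a case distinction. *)
exists (TPref t1 t2) => A a b KA /=.
split=> [[/(t1P _ _ _ KA)[[]]|[/(t2P _ _ _ KA)[[]]]] //|[Ga Oab]].
have [aw|naw] := classic (meets a w a w'); first by left; apply/t1P.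
by right; split=> [|[z /(t1P _ _ _ KA)[[]]] //]; apply/t2P.
Qed.

Lemma forward_term_definable (O : operation n) : fo_definable O ->
  function_preserving O -> forward_over (@Kpf n) O -> term_definable_over (@Kpf n) O.
Proof.
move=> fo fp fwd; have [k loc] := forward_local fo fwd.
have [m near_O] := forward_near fo fwd fp.
(* At most [m] letters lead from [a] to [b], and [k] more compare values there. *)
have [W WP] := words_le_finite n (m + k).
have [A a b KA|A A' a b a' w KA KA' _ _ ps_aa' wm ab|t tP] :=
    @term_of_tests O m [seq (w, w') | w <- W, w' <- W] fp near_O
      (fun A a => True) (word_term [::]).
- by rewrite eval_word_term; split=> [|[]].
- apply: (forward_word_local KA KA' loc _ wm ab) => u v p v' vk v'k.
  by apply: (ps_aa' (v, v')); apply: allpairs_f; apply: WP.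
by exists t => A KA a b; rewrite tP //; split=> [|[]].
Qed.

End Terms.

Theorem theorem11 (n : nat) (hn : 0 < n) (O : operation n)
    (hO : fo_definable O) :
  (function_preserving O /\ forward_over (@Kpf n) O) <->
  term_definable_over (@Kpf n) O.
Proof.
split=> [[fp fwd]|]; last exact: term_definable_forward.
exact: forward_term_definable.
Qed.
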